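(* Let $K$ be a convex body in $\mathbb{E}^d$, $d \geq 3$, and let $\{z_{\beta}\}_{\beta \in \mathcal{B}} \subset \mathbb{E}^d \setminus K$ be a set of exterior points of $K$ such that: (i) for every supporting line $l$ of $K$ there exists $\beta \in \mathcal{B}$ with $z_{\beta} \in l$; (ii) for a fixed integer $k$ with $3 \leq k \leq d$, and for all $\beta \in \mathcal{B}$, every $k$-dimensional visual cone $C_k(z_{\beta}, K)$ is polyhedral. Then $K$ is a polytope.
   Context: A convex body is a compact convex subset of $\mathbb{E}^d$ with non-empty interior. A line $l$ is a supporting line of $K$ if $l \cap K \neq \emptyset$ and $l \cap K \subset \partial K$. A polytope is the convex hull of finitely many points. For a set $V \subset \mathbb{E}^d$ and a point $z \notin V$, the (full-dimensional) visual cone of $V$ with apex $z$ is $C(z,V) = \{ z + t(x - z) : x \in V,\ t \geq 0\}$. For $2 \le k \le d$ and a $k$-dimensional affine subspace $H$ with $z \in H$ and $H \cap \operatorname{int} V \neq \emptyset$, the $k$-dimensional visual cone is $C_k(z,V) = C(z,V) \cap H$ (for $k=d$, $H=\mathbb{E}^d$ and $C_d(z,V)=C(z,V)$); ''every $k$-dimensional visual cone'' means this for every such $H$. A cone with apex $z$ in a $k$-dimensional affine space $H$ is polyhedral if it is a non-empty intersection of finitely many closed half-spaces of $H$ (a translate of a polyhedral cone with apex at the origin). *)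

(* Defs.v *)
(* Euclidean space E^d is 'rV[R]_d over R : realType,
   with MathComp-Analysis' matrix topology (equivalent to the Euclidean one). *)
From HB Require Import structures.
From mathcomp Require Import all_boot all_order all_algebra.
From mathcomp Require Import all_classical all_reals all_analysis.
Set Implicit Arguments. Unset Strict Implicit. Unset Printing Implicit Defensive.
Import Order.TTheory GRing.Theory Num.Theory.
Import numFieldNormedType.Exports.
Local Open Scope classical_set_scope.
Local Open Scope ring_scope.

Section Defs.
Variables (R : realType) (d : nat).
Notation E := 'rV[R]_d.

Definition convex_body (K : set E) : Prop :=
  compact K /\ convex_set K /\ (interior K !=set0).

Definition bdry (K : set E) : set E := closure K `\` interior K.

Definition line (p v : E) : set E := [set p + t *: v | t in [set: R]].

Definition supporting_line (K : set E) (l : set E) : Prop :=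
  exists p v : E, v != 0 /\ l = line p v /\
    (l `&` K !=set0) /\ (l `&` K `<=` bdry K).

Definition conv_hull_seq (s : seq E) : set E :=
  [set x | exists w : 'I_(size s) -> R,
     (forall i, 0 <= w i) /\ \sum_(i < size s) w i = 1 /\
     x = \sum_(i < size s) w i *: s`_i].
Definition polytope (K : set E) : Prop := exists s : seq E, K = conv_hull_seq s.

Definition visual_cone (z : E) (V : set E) : set E :=
  [set y : E | exists t : R, 0 <= t /\ exists2 x : E, V x & y = z + t *: (x - z)].

Definition affine_sub (k : nat) (z : E) (B : 'M[R]_(k, d)) : set E :=
  [set z + u *m B | u in [set: 'rV[R]_k]].

Definition polyhedral_cone_in (H : set E) (z : E) (C : set E) : Prop :=
  exists (n : nat) (a : 'I_n -> E),
    C = H `&` [set x | forall i, (a i *m (x - z)^T) 0 0 <= 0] /\ C !=set0.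

Definition all_k_visual_cones_polyhedral (k : nat) (z : E) (V : set E) : Prop :=
  forall B : 'M[R]_(k, d), \rank B = k ->
    affine_sub z B `&` interior V !=set0 ->
    polyhedral_cone_in (affine_sub z B) z (visual_cone z V `&` affine_sub z B).

End Defs.

(* Main.v *)
Require Import Defs.
From HB Require Import structures.
From mathcomp Require Import all_boot all_order all_algebra.
From mathcomp Require Import all_classical all_reals all_analysis.
From mathcomp Require Import ring lra.
Import Order.TTheory GRing.Theory Num.Theory.
Import numFieldNormedType.Exports.
Local Open Scope classical_set_scope.
Local Open Scope ring_scope.

(* Say that a convex cone D is conically closed if D + Rq is closed for every
   q in D. Such a cone is finitely generated, by induction on the codimension of
   a subspace L contained in D: for q in D outside L, the cone D + Rq contains
   L + Rq, so it is finitely generated, which forces D to agree near q with a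
   finitely generated cone; compactness of the unit sphere of a complement of L
   concludes.
   This criterion applies to three kinds of cones: those cut out by finitely
   many inequalities (Minkowski-Weyl); the visual cones, where closedness of
   D + Rq is tested in the k-dimensional section through q, a limit point v and
   an interior direction (hence k >= 3); and the cone N of affine
   inequalities valid on K. For the latter, let q in N and let v be in the
   closure of N + Rq. If v is negative on the face of K where q is tight, then
   v + tq is valid for large t by compactness. Otherwise q and v both vanish at
   some y in K, hence along a line through y, as d >= 3. That line supports K,
   so it contains some z_b, and v + tq is valid as soon as it is nonpositive on
   the finitely many generators of the visual cone at z_b. *)

(** * Inner product on row vectors, and nonnegative combinations *)

Definition dot {R : realType} {n : nat} (a b : 'rV[R]_n) : R := (a *m b^T) 0 0.

Lemma dotE {R : realType} {n} (a b : 'rV[R]_n) :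
  dot a b = \sum_j a 0 j * b 0 j.
Proof. by rewrite /dot mxE; apply: eq_bigr => j _; rewrite mxE. Qed.

Lemma dotC {R : realType} {n} (a b : 'rV[R]_n) : dot a b = dot b a.
Proof. by rewrite !dotE; apply: eq_bigr => j _; rewrite mulrC. Qed.

Lemma dotDl {R : realType} {n} (a b c : 'rV[R]_n) :
  dot (a + b) c = dot a c + dot b c.
Proof. by rewrite /dot mulmxDl mxE. Qed.

Lemma dotZl {R : realType} {n} t (a b : 'rV[R]_n) :
  dot (t *: a) b = t * dot a b.
Proof. by rewrite /dot -scalemxAl mxE. Qed.

Lemma dotDr {R : realType} {n} (a b c : 'rV[R]_n) :
  dot a (b + c) = dot a b + dot a c.
Proof. by rewrite dotC dotDl !(dotC _ a). Qed.

Lemma dotZr {R : realType} {n} t (a b : 'rV[R]_n) :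
  dot a (t *: b) = t * dot a b.
Proof. by rewrite dotC dotZl dotC. Qed.

Lemma dotBr {R : realType} {n} (a b c : 'rV[R]_n) :
  dot a (b - c) = dot a b - dot a c.
Proof. by rewrite dotDr -scaleN1r dotZr mulN1r. Qed.

Lemma dot0r {R : realType} {n} (a : 'rV[R]_n) : dot a 0 = 0.
Proof. by rewrite -(scale0r 0) dotZr mul0r. Qed.

Lemma dot0l {R : realType} {n} (a : 'rV[R]_n) : dot 0 a = 0.
Proof. by rewrite dotC dot0r. Qed.

Lemma dot_ge0 {R : realType} {n} (a : 'rV[R]_n) : 0 <= dot a a.
Proof. by rewrite dotE sumr_ge0 // => j _; rewrite -expr2 sqr_ge0. Qed.

Lemma dot_eq0 {R : realType} {n} (a : 'rV[R]_n) : (dot a a == 0) = (a == 0).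
Proof.
apply/eqP/eqP => [|->]; last exact: dot0r.
rewrite dotE => /psumr_eq0P a0; apply/rowP => j; rewrite mxE; apply/eqP.
by rewrite -sqrf_eq0 expr2 a0 // => i _; rewrite -expr2 sqr_ge0.
Qed.

Lemma dot_sub_sq {R : realType} {n} (a b : 'rV[R]_n) :
  dot (a - b) (a - b) = dot a a - 2 * dot a b + dot b b.
Proof. by rewrite dotBr !(dotC (a - b)) !dotBr (dotC b a); ring. Qed.

Lemma cvg_dot {R : realType} {n} {T : Type} {F : set_system T} {FF : Filter F}
    (f g : T -> 'rV[R]_n) a b :
  f @ F --> a -> g @ F --> b -> dot (f x) (g x) @[x --> F] --> dot a b.
Proof.
move=> fa gb; rewrite dotE.
rewrite (_ : (fun _ => _) = fun x => \sum_j f x 0 j * g x 0 j); last first.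
  by apply/funext => x; rewrite dotE.
elim: (index_enum _) => [|j s IH].
  rewrite big_nil (_ : (fun _ => _) = cst 0); first exact: cvg_cst.
  by apply/funext => x; rewrite big_nil.
rewrite big_cons (_ : (fun _ => _) =
  fun x => f x 0 j * g x 0 j + \sum_(i <- s) f x 0 i * g x 0 i); last first.
  by apply/funext => x; rewrite big_cons.
apply: (cvgD _ IH); apply: cvgM.
  exact: (cvg_comp _ _ fa (@coord_continuous R 1 n 0 j a)).
exact: (cvg_comp _ _ gb (@coord_continuous R 1 n 0 j b)).
Qed.

Lemma dot_continuous {R : realType} {n} (a : 'rV[R]_n) : continuous (dot a).
Proof.
move=> b; exact: (@cvg_dot R n _ (nbhs b) _ (fun=> a) id a b (cvg_cst _) cvg_id).
Qed.

(* Caratheodory: a shortest nonnegative representation has independent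
   support, hence is a linear function of the represented vector. *)
Lemma nonneg_comb_indep {R : realType} {m n} (G : 'M[R]_(m, n)) (w : 'rV[R]_m) :
  (forall i, 0 <= w 0 i) ->
  exists A : {set 'I_m}, exists2 w' : 'rV[R]_m,
    (forall i, 0 <= w' 0 i) /\ w' *m G = w *m G &
    let P := diag_mx (\row_i (i \in A)%:R) in
    w' *m P = w' /\ kermx (P *m G) *m P = 0.
Proof.
have [k] := ubnP #|[set i | w 0 i != 0]%SET|; elim: k w => // k IH w.
set A := [set i | _]%SET; rewrite ltnS => lek w0.
pose P : 'M[R]_m := diag_mx (\row_i (i \in A)%:R).
have PE (u : 'rV[R]_m) i : (u *m P) 0 i = u 0 i * (i \in A)%:R.
  by rewrite mul_mx_diag !mxE.
(* [kermx (P *m G) *m P = 0] means that the rows of [G] indexed by [A] are linearly independent. *)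
have [ker0|] := eqVneq (kermx (P *m G) *m P) 0.
  exists A, w => //; split=> //; apply/rowP => i; rewrite PE inE.
  by case: eqP => [->|_]; rewrite ?mul0r ?mulr1.
move=> /rowV0Pn[c0 /submxP[u ->]] c_neq0.
have [c [cG [i0 ci0] cA]] : exists c : 'rV[R]_m,
    [/\ c *m G = 0, exists i, 0 < c 0 i & forall i, i \notin A -> c 0 i = 0].
  set c := u *m _ in c_neq0.
  have cG : c *m G = 0 by rewrite /c -2!mulmxA mulmx_ker mulmx0.
  have cA i : i \notin A -> c 0 i = 0.
    by rewrite /c mulmxA PE => /negbTE ->; rewrite mulr0.
  have [i ci] : exists i, c 0 i != 0.
    apply/existsP; apply: contraNT c_neq0 => /existsPn ci0.
    by apply/eqP/rowP => i; rewrite [RHS]mxE; apply/eqP; have := ci0 i; rewrite negbK.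
  case: (ltgtP (c 0 i) 0) ci => // ci _; last by exists c; split=> //; exists i.
  exists (- c); split; first by rewrite mulNmx cG oppr0.
    by exists i; rewrite mxE oppr_gt0.
  by move=> j jA; rewrite mxE cA // oppr0.
(* Subtracting [c] with the smallest ratio keeps all weights nonnegative and makes the [i]-th one
   vanish, so the support shrinks. *)
have [i ci imin] := @arg_minP _ _ _ i0 (fun i => 0 < c 0 i)
  (fun i => w 0 i / c 0 i) ci0.
pose w' := w - (w 0 i / c 0 i) *: c.
have w'0 j : 0 <= w' 0 j.
  rewrite !mxE subr_ge0; have [cj|cj] := ltP 0 (c 0 j).
    by rewrite -ler_pdivlMr // imin.
  by apply: le_trans (w0 j); rewrite mulr_ge0_le0 // divr_ge0 // ltW.
have w'i : w' 0 i = 0 by rewrite !mxE divfK ?subrr // gt_eqF.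
have [|B [w2 [w2_ge0 w2G] Bw2]] := IH w' _ w'0.
  apply: leq_trans lek; apply/proper_card/properP; split.
    apply/fintype.subsetP => j; rewrite inE; apply: contraNT => jA.
    by move: (jA); rewrite inE negbK => /eqP wj; rewrite !mxE wj (cA j) // mulr0 subr0.
  exists i; last by rewrite inE w'i eqxx.
  by apply: contraTT ci => iA; rewrite cA // ltxx.
exists B, w2 => //; split=> //.
by rewrite w2G mulmxBl -scalemxAl cG scaler0 subr0.
Qed.

(** On an independent support the weights are a linear function of [v], hence small near [0]; only
    finitely many supports occur. *)
Lemma nonneg_comb_small {R : realType} {m n} (G : 'M[R]_(m, n)) :
  \forall v \near (0 : 'rV[R]_n),
    (exists2 w : 'rV[R]_m, (forall i, 0 <= w 0 i) & v = w *m G) ->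
    exists2 w : 'rV[R]_m, (forall i, 0 <= w 0 i <= 1) & v = w *m G.
Proof.
pose P (A : {set 'I_m}) : 'M[R]_m := diag_mx (\row_i (i \in A)%:R).
pose X A := pinvmx (P A *m G) *m P A.
have XE A i v : (v *m X A) 0 i = dot (col i (X A))^T v.
  by rewrite dotC /dot trmxK !mxE; apply: eq_bigr => j _; rewrite [in RHS]mxE.
have X1 A i : \forall v \near (0 : 'rV[R]_n), (v *m X A) 0 i < 1.
  have := @dot_continuous R n (col i (X A))^T 0.
  rewrite /continuous_at dot0r => /cvgr_lt/(_ 1 ltr01).
  by apply: filterS => v; rewrite XE.
have {}X1 A : \forall v \near (0 : 'rV[R]_n), forall i, (v *m X A) 0 i < 1.
  exact: filter_forall (X1 A).
have {}X1 : \forall v \near (0 : 'rV[R]_n), forall A i, (v *m X A) 0 i < 1.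
  exact: (@filter_forall _ {set 'I_m} (fun A v => forall i, (v *m X A) 0 i < 1) _ _ X1).
apply: filterS X1.
move=> v vX [w w0 vE].
have [A [w' [w'0 w'G] [w'P ker0]]] := nonneg_comb_indep G w w0.
(* The rows of [1 - M M^+], with [M = P A *m G], lie in the kernel of [M], which [P A] annihilates
   by independence. *)
have PX : P A *m G *m X A = P A.
  have /submxP[D KE] :
      (1%:M - P A *m G *m pinvmx (P A *m G) <= kermx (P A *m G))%MS.
    by apply/sub_kermxP; rewrite mulmxBl mul1mx mulmxKpV ?subrr.
  have : (1%:M - P A *m G *m pinvmx (P A *m G)) *m P A = 0.
    by rewrite KE -mulmxA ker0 mulmx0.
  by rewrite mulmxBl mul1mx => /subr0_eq E; rewrite [RHS]E; exact: mulmxA.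
exists w'; last by rewrite vE.
have w'E : w' = v *m X A.
  by rewrite vE -w'G -[in LHS]w'P -[in RHS]w'P -[diag_mx _]/(P A) -[in LHS]PX
    !mulmxA.
by move=> i; rewrite w'0 w'E; exact/ltW/vX.
Qed.

(** * Finitely generated cones *)

Definition convex_cone {R : realType} {n} (D : set 'rV[R]_n) : Prop :=
  [/\ D 0, forall x y, D x -> D y -> D (x + y)
    & forall t x, 0 <= t -> D x -> D (t *: x)].

(** Impredicative form: a linear inequality passes from the generators to the whole cone by taking
    for [C] the set where it holds. *)
Definition cone_gen {R : realType} {n} (s : seq 'rV[R]_n) : set 'rV[R]_n :=
  [set p | forall C, convex_cone C -> {in s, forall g, C g} -> C p].

Definition finitely_generated {R : realType} {n} (D : set 'rV[R]_n) : Prop :=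
  exists2 s : seq 'rV[R]_n, {in s, forall g, D g} & D `<=` cone_gen s.

Definition add_line {R : realType} {n} (D : set 'rV[R]_n) q : set 'rV[R]_n :=
  [set p | exists t, D (p + t *: q)].

Lemma convex_cone_sum {R : realType} {n} (D : set 'rV[R]_n) (I : Type)
    (r : seq I) (F : I -> 'rV[R]_n) :
  convex_cone D -> (forall i, D (F i)) -> D (\sum_(i <- r) F i).
Proof. by move=> [D0 DD _] DF; elim/big_ind: _ => // i _; exact: DF. Qed.

Lemma cone_gen_cone {R : realType} {n} (s : seq 'rV[R]_n) :
  convex_cone (cone_gen s).
Proof.
split=> [C [] //|x y sx sy C cC sC|t x t0 sx C cC sC].
  by case: (cC) => _ CD _; apply: CD; [exact: sx|exact: sy].
by case: (cC) => _ _ CZ; apply: CZ => //; exact: sx.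
Qed.

Lemma mem_cone_gen {R : realType} {n} (s : seq 'rV[R]_n) g :
  g \in s -> cone_gen s g.
Proof. by move=> sg C _; exact. Qed.

Lemma sub_cone_gen {R : realType} {n} (s t : seq 'rV[R]_n) p :
  {in s, forall g, cone_gen t g} -> cone_gen s p -> cone_gen t p.
Proof. by move=> st sp; apply: sp => //; exact: cone_gen_cone. Qed.

Lemma cone_gen_map {R : realType} {n} {T : eqType} (x0 : T) (f : T -> 'rV[R]_n)
    (s : seq T) p : cone_gen [seq f x | x <- s] p ->
  exists2 w : 'rV[R]_(size s), (forall i, 0 <= w 0 i) &
    p = w *m \matrix_i f (nth x0 s i).
Proof.
move=> sp; apply: (sp [set p | exists2 w : 'rV[R]_(size s),
  (forall i, 0 <= w 0 i) & p = w *m \matrix_i f (nth x0 s i)]).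
  split=> [|x y [v v0 ->] [w w0 ->]|t x t0 [w w0 ->]].
  - by exists 0; [move=> i; rewrite mxE|rewrite mul0mx].
  - by exists (v + w); [move=> i; rewrite mxE addr_ge0|rewrite mulmxDl].
  - by exists (t *: w); [move=> i; rewrite mxE mulr_ge0|rewrite scalemxAl].
move=> _ /mapP[g gs ->].
have gi : (index g s < size s)%N by rewrite index_mem.
exists (delta_mx 0 (Ordinal gi)); first by move=> i; rewrite mxE ler0n.
by rewrite -rowE rowK /= nth_index.
Qed.

Lemma cone_gen_comb {R : realType} {n} (s : seq 'rV[R]_n) p : cone_gen s p ->
  exists2 w : 'rV[R]_(size s), (forall i, 0 <= w 0 i) &
    p = w *m \matrix_i s`_i.
Proof. by rewrite -{1}[s]map_id; exact: cone_gen_map. Qed.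

Lemma cone_gen_rows {R : realType} {n m} (L : 'M[R]_(m, n)) (u : 'rV[R]_m) s :
  (forall i, row i L \in s) -> (forall i, - row i L \in s) ->
  cone_gen s (u *m L).
Proof.
move=> sL sNL; rewrite mulmx_sum_row; have cs := cone_gen_cone s.
apply: (convex_cone_sum _ _ _ _ cs) => i; case: cs => _ _ sZ.
have [u0|u0] := leP 0 (u 0 i); first by apply: sZ => //; exact: mem_cone_gen.
rewrite -[u 0 i]opprK scaleNr -scalerN; apply: sZ; last exact: mem_cone_gen.
by rewrite oppr_ge0 ltW.
Qed.

Lemma add_line_cone {R : realType} {n} (D : set 'rV[R]_n) q :
  convex_cone D -> convex_cone (add_line D q).
Proof.
move=> [D0 DD DZ]; split=> [|x y [t Dx] [u Dy]|t x t0 [u Dx]].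
- by exists 0; rewrite scale0r addr0.
- by exists (t + u); rewrite scalerDl addrACA; exact: DD.
- by exists (t * u); rewrite -scalerA -scalerDr; exact: DZ.
Qed.

Lemma sub_add_line {R : realType} {n} (D : set 'rV[R]_n) q : D `<=` add_line D q.
Proof. by move=> p Dp; exists 0; rewrite scale0r addr0. Qed.

(** Adding nonnegative multiples of [p] and [q] stays in [D], so their two coefficients can be
    raised to a common value: the lines along [p] and [q] merge into the one along [p + q]. *)
Lemma add_line2 {R : realType} {n} (D : set 'rV[R]_n) q q' t :
  convex_cone D -> D q -> D (q' + t *: q) ->
  add_line (add_line D q) q' = add_line D (q' + t *: q + q).
Proof.
move=> [_ DD DZ] Dq; set p := q' + t *: q => Dp.
have DZ' c x : 0 <= c -> D x -> D (c *: x) by exact: DZ.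
apply/seteqP; split=> v [].
  move=> s [u Dv]; set u' := u - s * t.
  have {}Dv : D (v + s *: p + u' *: q).
    rewrite /p /u' scalerDr scalerA scalerBl.
    by rewrite !addrA (addrAC _ _ (u *: q)) addrK.
  exists (Num.max s u').
  have -> : v + Num.max s u' *: (p + q) =
    v + s *: p + u' *: q + ((Num.max s u' - s) *: p + (Num.max s u' - u') *: q).
    by apply/rowP => i; rewrite !mxE; ring.
  apply: (DD) => //.
  by apply: DD; apply: (DZ) => //; rewrite subr_ge0 le_max lexx ?orbT.
move=> s Dv; exists s, (s * t + s).
by move: Dv; rewrite /p !scalerDr scalerA !addrA scalerDl !addrA.
Qed.

(* Since [D + Rq] is generated by elements of [D] together with [q] and [-q],
   and small vectors need only a small coefficient on [-q], that coefficient is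
   absorbed by [q] itself for points near [q]. *)
Lemma finitely_generated_near {R : realType} {n} (D : set 'rV[R]_n) q :
  convex_cone D -> D q -> finitely_generated (add_line D q) ->
  exists2 s : seq 'rV[R]_n, {in s, forall g, D g} &
    \forall p \near q, D p -> cone_gen s p.
Proof.
move=> [D0 DD DZ] Dq [s sD Ds].
have /choice[T sT] : forall g, exists t, g \in s -> D (g + t *: q).
  move=> g; have [gs|_] := boolP (g \in s); last by exists 0.
  by have [t ?] := sD _ gs; exists t.
pose s' := q :: [seq g + T g *: q | g <- s].
exists s'.
  move=> g; rewrite inE => /predU1P[->//|/mapP[h hs ->]]; exact: sT.
have cs' := cone_gen_cone s'; case: (cs') => _ s'D s'Z.
(* [p - q] lies in [D + Rq], and each of its generators is [(g + T g *: q) - T g *: q]. *)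
have s2 p : D p -> cone_gen (- q :: s') (p - q).
  move=> Dp; apply: (@sub_cone_gen _ _ s); last first.
    by apply: Ds; exists 1; rewrite scale1r addrNK.
  move=> g gs; have [_ DD2 DZ2] := cone_gen_cone (- q :: s').
  rewrite -[g](addrK (T g *: q)); apply: DD2.
    by apply: mem_cone_gen; rewrite !inE (map_f (fun g => g + T g *: q) gs) !orbT.
  have [T0|T0] := leP 0 (T g).
    by rewrite -scalerN; apply: DZ2 => //; apply: mem_cone_gen; rewrite mem_head.
  rewrite -scaleNr; apply: DZ2; first by rewrite oppr_ge0 ltW.
  by apply: mem_cone_gen; rewrite !inE eqxx orbT.
have pq : (fun p => p - q) @ q --> (0 : 'rV[R]_n).
  by rewrite -(subrr q); exact: (cvgB cvg_id (cvg_cst _)).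
pose G := \matrix_(i < size (- q :: s')) (- q :: s')`_i.
have H : \forall p \near q,
    (exists2 w : 'rV[R]_(size (- q :: s')), (forall i, 0 <= w 0 i) & p - q = w *m G) ->
    exists2 w : 'rV[R]_(size (- q :: s')), (forall i, 0 <= w 0 i <= 1) & p - q = w *m G.
  exact: pq (nonneg_comb_small G).
apply: filterS H => p H Dp.
have [w w01 pqE] := H (cone_gen_comb _ _ (s2 _ Dp)).
rewrite -[p](subrK q) pqE mulmx_sum_row big_ord_recl rowK /=.
rewrite scalerN addrAC; apply: s'D.
  rewrite (_ : - _ + q = (1 - w 0 ord0) *: q); last first.
    by rewrite scalerBl scale1r addrC.
  apply: s'Z; first by have /andP[_] := w01 ord0; rewrite subr_ge0.
  by apply: mem_cone_gen; rewrite mem_head.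
apply: (convex_cone_sum _ _ _ _ cs') => i; rewrite rowK; apply: s'Z.
  by case/andP: (w01 (lift ord0 i)).
by apply: mem_cone_gen; apply: (@mem_nth _ 0 s' i); exact: ltn_ord.
Qed.

(** The row space of [L] is a subspace inside [D]. The induction is on its codimension: it grows by
    [q] when [D] is replaced by [D + Rq]. *)
Lemma finitely_generated_closed_aux {R : realType} {n} (D : set 'rV[R]_n)
    (L : 'M[R]_n) :
  convex_cone D -> (forall q, D q -> closed (add_line D q)) ->
  (forall u, D (u *m L)) -> finitely_generated D.
Proof.
have [k] := ubnP (n - \rank L); elim: k D L => // k IH D L; rewrite ltnS => leLk.
move=> cD clD LD; have [D0 DD DZ] := cD.
(* [Q] is a projection with kernel the row space of [L]. It maps [D] into itself, so only the unit
   vectors of [D] fixed by [Q] need local generators. *)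
pose Q := 1%:M - pinvmx L *m L.
have LQ : L *m Q = 0.
  by rewrite mulmxBr mulmx1 mulmxA mulmxKpV ?subrr.
have QQ : Q *m Q = Q by rewrite {1}/Q mulmxBl mul1mx -mulmxA LQ mulmx0 subr0.
have pQ (p : 'rV_n) : p = p *m Q + p *m pinvmx L *m L.
  by rewrite mulmxBr mulmx1 mulmxA subrK.
have DQ p : D p -> D (p *m Q).
  move=> Dp; rewrite mulmxBr mulmx1 mulmxA -mulNmx; exact: DD.
pose S := [set p | [/\ D p, `|p| = 1 & p *m Q = p]].
have clD0 : closed D.
  have := clD 0 D0; congr closed; apply/seteqP; split=> p; last exact: sub_add_line.
  by case=> t; rewrite scaler0 addr0.
have cS : compact S.
  apply: bounded_closed_compact.
    by exists 1; split=> // x x1 p [_ p1 _]; rewrite /= p1 ltW.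
  have -> : S = D `&` ((fun p : 'rV[R]_n => `|p|) @^-1` [set 1] `&`
     \bigcap_(j in [set: 'I_n]) (dot ((col j Q)^T - delta_mx 0 j) @^-1` [set 0])).
    have dE p j : dot ((col j Q)^T - delta_mx 0 j) p = (p *m Q) 0 j - p 0 j.
      rewrite dotC dotBr /dot trmxK trmx_delta -colE !mxE.
      by congr (_ - _); apply: eq_bigr => i _; rewrite mxE.
    apply/seteqP; split=> p.
      by move=> [Dp p1 pQE]; split=> //; split=> // j _; rewrite /= dE pQE subrr.
    move=> [Dp [p1 pQE]]; split=> //; apply/rowP => j.
    by apply/eqP; rewrite -subr_eq0 -dE; apply/eqP; exact: pQE.
  apply: closedI => //; apply: closedI.
    by apply: preimage_closed; [move=> x _; exact: norm_continuous|exact: closed_eq].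
  apply: closed_bigI => j _; apply: preimage_closed; last exact: closed_eq.
  by move=> x _; exact: dot_continuous.
have nearS q : exists s : seq 'rV[R]_n, S q -> {in s, forall g, D g} /\
    \forall p \near q, D p -> cone_gen s p.
  have [Sq|nSq] := pselect (S q); last by exists [::].
  have [Dq q1 qQ] := Sq.
  have qL : ~~ (q <= L)%MS.
    apply/negP => /submxP[u qE]; move: q1.
    by rewrite -qQ qE -mulmxA LQ mulmx0 normr0 => /esym/eqP; rewrite oner_eq0.
  have [] := finitely_generated_near D q cD Dq; last by move=> s ? ?; exists s.
  apply: (IH _ (L + q)%MS).
  - have ltr : (\rank L < \rank (L + q)%MS)%N.
      apply: rank_ltmx; rewrite ltmxE addsmxSl /=.
      by apply: contra qL; apply: submx_trans; exact: addsmxSr.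
    have lern := rank_leq_row (L + q)%MS.
    by apply: leq_trans leLk; rewrite ltn_sub2l // (leq_trans ltr).
  - exact: add_line_cone.
  (* Conical closedness is inherited by [D + Rq], as two added lines amount to one. *)
  - move=> q' [t Dq']; rewrite (add_line2 _ _ _ t) //; apply: clD; exact: DD.
  - move=> u; have /sub_addsmxP[[u1 u2] /= ->] : (u *m (L + q)%MS <= L + q)%MS.
      exact: submxMl.
    exists (- u2 0 0); rewrite [u2]mx11_scalar mul_scalar_mx mxE /= mulr1n.
    by rewrite -addrA -scalerDl subrr scale0r addr0.
have /choice[s sS] := nearS.
have := cS; rewrite compact_cover =>
  /(_ _ S (fun q => interior [set p | D p -> cone_gen (s q) p]))[].
- by move=> q _; exact: open_interior.
- by move=> q Sq; exists q => //; have [_] := sS q Sq.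
move=> I IS SI.
(* The rows of [L] with both signs generate the subspace; the finite subcover contributes the
   rest. *)
pose t := [seq row i L | i <- enum 'I_n] ++ [seq - row i L | i <- enum 'I_n] ++
  flatten [seq s q | q <- finmap.enum_fset I].
have rowD i c : D (c *: row i L).
  by rewrite rowE scalemxAl; exact: LD.
exists t.
  move=> g; rewrite !mem_cat => /or3P[/mapP[i _ ->]|/mapP[i _ ->]|].
  - by rewrite -[row _ _]scale1r.
  - by rewrite -scaleN1r.
  - move=> /flattenP[_ /mapP[q /IS]] /[!inE] Sq -> gs.
    by have [sD _] := sS q Sq; exact: sD.
have [_ tD tZ] := cone_gen_cone t.
move=> p Dp; rewrite (pQ p); apply: tD; last first.
  apply: cone_gen_rows => i; rewrite !mem_cat; apply/or3P.
    by apply/Or31/(map_f (fun i => row i L)); rewrite mem_enum.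
  by apply/Or32/(map_f (fun i => - row i L)); rewrite mem_enum.
have [->|pQ0] := eqVneq (p *m Q) 0; first by case: (cone_gen_cone t).
set y := p *m Q in pQ0 *.
rewrite -[y]scale1r -(@divff _ `|y|) ?normr_eq0 // -scalerA; apply: tZ => //.
have Sy : S (`|y|^-1 *: y).
  split; first by apply: DZ; [rewrite invr_ge0|exact: DQ].
    by rewrite normrZ normfV normr_id mulVf ?normr_eq0.
  by rewrite -scalemxAl /y -mulmxA QQ.
have [q qI /interior_subset h] := SI _ Sy.
apply: (@sub_cone_gen _ _ (s q)); last by apply: h; case: Sy.
move=> g gs; apply: mem_cone_gen; rewrite !mem_cat; apply/or3P/Or33.
by apply/flattenP; exists (s q) => //; apply: map_f.
Qed.

Lemma finitely_generated_closed {R : realType} {n} (D : set 'rV[R]_n) :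
  convex_cone D -> (forall q, D q -> closed (add_line D q)) ->
  finitely_generated D.
Proof.
move=> cD clD; apply: (finitely_generated_closed_aux D 0) => // u.
by rewrite mulmx0; case: cD.
Qed.

(** An index with [a i < 0] only asks for [t >= - b i / a i], and enlarging [t] never hurts, so
    finitely many indices share one [t]. *)
Lemma absorb_negative {R : realType} (I : eqType) (s : seq I) (a b : I -> R) :
  {in s, forall i, a i <= 0} -> {in s, forall i, a i = 0 -> b i <= 0} ->
  exists t, {in s, forall i, b i + t * a i <= 0}.
Proof.
elim: s => [|i s IH] a0 ab; first by exists 0.
have [||t tP] := IH.
- by move=> j js; apply: a0; rewrite inE js orbT.
- by move=> j js; apply: ab; rewrite inE js orbT.
have le_absorb j u : j \in i :: s -> b j + t * a j <= 0 -> t <= u -> b j + u * a j <= 0.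
  move=> js bj tu; apply: le_trans bj; rewrite lerD2l.
  by apply: ler_wnM2r => //; exact: a0.
have [ai|ai] := eqVneq (a i) 0.
  exists t => j; rewrite inE => /predU1P[->|/tP//].
  by rewrite ai mulr0 addr0; apply: ab; rewrite ?mem_head.
have {}ai : a i < 0 by rewrite lt_neqAle ai a0 ?mem_head.
exists (Num.max t (- b i / a i)) => j; rewrite inE => /predU1P[->|js]; last first.
  apply: le_absorb; [by rewrite inE js orbT|exact: tP|by rewrite le_max lexx].
have : - b i / a i <= Num.max t (- b i / a i) by rewrite le_max lexx orbT.
by rewrite ler_ndivrMr //; set u := Num.max _ _; lra.
Qed.

(* Minkowski-Weyl: modulo [Rq], only the inequalities tight at [q] remain. *)
Lemma finitely_generated_polyhedral {R : realType} {n} (s : seq 'rV[R]_n) :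
  finitely_generated [set p | {in s, forall a, dot a p <= 0}].
Proof.
set P := [set p | _]; apply: finitely_generated_closed.
  split=> [a _|x y Px Py a sa|t x t0 Px a sa].
  - by rewrite dot0r.
  - by rewrite -[leRHS]addr0 dotDr lerD ?Px ?Py.
  - by rewrite dotZr mulr_ge0_le0 ?Px.
move=> q Pq.
have -> : add_line P q =
    \bigcap_(a in [set a | a \in s /\ dot a q = 0]) (dot a @^-1` [set x | x <= 0]).
  apply/seteqP; split=> p.
    by move=> [t Pt] a [sa aq]; have := Pt a sa; rewrite dotDr dotZr aq mulr0 addr0.
  move=> pP; have [|a sa aq|t tP] := @absorb_negative R _ s (dot^~ q) (dot^~ p).
  - exact: Pq.
  - by apply: pP.
  - by exists t => a sa; rewrite dotDr dotZr; exact: tP.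
apply: closed_bigI => a _; apply: preimage_closed; last exact: closed_le.
by move=> x _; exact: dot_continuous.
Qed.

(** * Finite generation of visual cones *)

Lemma le0_of_small {R : realType} (a b : R) :
  (forall t, 0 < t -> t <= 1 -> a <= t * b) -> a <= 0.
Proof.
move=> ab; rewrite leNgt; apply/negP => a0.
(* [D] exceeds both [a] and [b], so [t = a / D] is at most [1] and gives [t * b < a]. *)
set D := a + `|b| + 1; have D0 : 0 < D by rewrite addr_gt0 // ltr_wpDr.
have aD : a / D <= 1 by rewrite ler_pdivrMr // mul1r /D -addrA lerDl addr_ge0.
have := ab (a / D) (divr_gt0 a0 D0) aD.
rewrite mulrAC ler_pdivlMr // ler_pM2l // /D.
by have := ler_norm b; lra.
Qed.

Lemma convex_set_comb {R : realType} {n} (K : set 'rV[R]_n) x y (t : R) :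
  convex_set K -> K x -> K y -> 0 <= t -> t <= 1 -> K (x + t *: (y - x)).
Proof.
move=> cK Kx Ky t0 t1.
have := cK y x (Itv01 t0 t1); rewrite !inE => /(_ Ky Kx); congr (K _).
rewrite [LHS](_ : _ = t *: y + (1 - t) *: x) //.
by apply/rowP => i; rewrite !mxE; ring.
Qed.

(** The first [\rank W] rows of the invertible matrix [row_ebase W] span the row space of [W]; its
    first [k] rows then do the job. *)
Lemma exists_row_superspace {R : realType} {m n} k (W : 'M[R]_(m, n)) :
  (m <= k)%N -> (k <= n)%N ->
  exists2 B : 'M[R]_(k, n), \rank B = k & (W <= B)%MS.
Proof.
move=> mk kn; exists (pid_mx k *m row_ebase W).
  by rewrite mxrankMfree ?row_free_unit ?row_ebase_unit // rank_pid_mx.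
apply/submxP; exists (col_ebase W *m pid_mx (\rank W)).
rewrite mulmxA -(mulmxA (col_ebase W)) mul_pid_mx.
have rk : (\rank W <= k)%N := leq_trans (rank_leq_row W) mk.
by rewrite (minn_idPl rk) (minn_idPr rk) mulmx_ebase.
Qed.

(* The visual cone translated so that its apex becomes the origin. *)
Definition sight_cone {R : realType} {d} (z : 'rV[R]_d) (K : set 'rV[R]_d) :
  set 'rV[R]_d := [set p | exists2 t, 0 <= t & exists2 x, K x & p = t *: (x - z)].

Lemma visual_coneE {R : realType} {d} (z : 'rV[R]_d) (K : set 'rV[R]_d) p :
  visual_cone z K (z + p) <-> sight_cone z K p.
Proof.
split=> [[t [t0 [x Kx /addrI ->]]]|[t t0 [x Kx ->]]]; exists t => //.
  by exists x.
by split=> //; exists x.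
Qed.

Lemma sight_cone_cone {R : realType} {d} (z : 'rV[R]_d) (K : set 'rV[R]_d) :
  convex_set K -> K !=set0 -> convex_cone (sight_cone z K).
Proof.
move=> cK [x0 Kx0]; split.
- by exists 0 => //; exists x0 => //; rewrite scale0r.
- move=> _ _ [t t0 [x Kx ->]] [u u0 [y Ky ->]].
  exists (t + u); first exact: addr_ge0.
  have [tu0|tu0] := eqVneq (t + u) 0.
    exists x => //; have t00 : t = 0 by lra.
    have u00 : u = 0 by lra.
    by rewrite t00 u00 !scale0r !addr0 scale0r.
  have tu : 0 < t + u by rewrite lt_neqAle eq_sym tu0 addr_ge0.
  exists (x + (u / (t + u)) *: (y - x)).
    apply: convex_set_comb => //; first by rewrite divr_ge0 // addr_ge0.
    by rewrite ler_pdivrMr // mul1r lerDr.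
  by apply/rowP => i; rewrite !mxE; field.
- move=> c _ c0 [t t0 [x Kx ->]]; exists (c * t); first exact: mulr_ge0.
  by exists x => //; rewrite scalerA.
Qed.

(** [o - z] is an interior direction of the cone, so any positive multiple of it pushes a limit
    point inside. *)
Lemma closure_add_line {R : realType} {d} (z o q v : 'rV[R]_d) (K : set 'rV[R]_d) :
  convex_set K -> interior K o -> closure (add_line (sight_cone z K) q) v ->
  forall e, 0 < e -> add_line (sight_cone z K) q (v + e *: (o - z)).
Proof.
move=> cK Ko clv e e0.
have cD : convex_cone (sight_cone z K).
  by apply: sight_cone_cone => //; exists o; exact: interior_subset.
have [_ ED _] := add_line_cone _ q cD.
(* For [w] close to [v], the point [o + e^-1 *: (v - w)] is still in [K]; using it instead of [o]
   makes up for replacing [v] by [w]. *)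
have shift : (fun w => o + e^-1 *: (v - w)) @ v --> o.
  have : (fun w => o + e^-1 *: (v - w)) @ v --> o + e^-1 *: (v - v).
    exact: (cvgD (cvg_cst _) (cvgZ (cvg_cst _) (cvgB (cvg_cst _) cvg_id))).
  by rewrite subrr scaler0 addr0.
have [w [Ew Kw]] := clv _ (shift _ Ko).
rewrite (_ : _ + _ = w + e *: (o + e^-1 *: (v - w) - z)); last first.
  by apply/rowP => i; rewrite !mxE; field; rewrite gt_eqF.
apply: ED => //; apply: sub_add_line; exists e; first exact: ltW.
by exists (o + e^-1 *: (v - w)).
Qed.

Lemma sight_cone_finitely_generated {R : realType} {d k} (z : 'rV[R]_d)
    (K : set 'rV[R]_d) :
  convex_set K -> interior K !=set0 -> (3 <= k)%N -> (k <= d)%N ->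
  all_k_visual_cones_polyhedral k z K -> finitely_generated (sight_cone z K).
Proof.
move=> cK [ o Ko] k3 kd polyK.
have Ko' : K o := interior_subset Ko.
have cD : convex_cone (sight_cone z K) by apply: sight_cone_cone => //; exists o.
apply: finitely_generated_closed => // q Dq v clv.
(* Including [o - z] makes the section pass through the interior point [o]. *)
pose W := col_mx (col_mx q v) (o - z).
have [B rB WB] := exists_row_superspace k W k3 kd.
move: WB; rewrite !col_mx_sub => /andP[/andP[qB vB] eB].
have affB p : (p <= B)%MS -> affine_sub z B (z + p).
  by move=> /submxP[u ->]; exists u.
have [|n [a [aE _]]] := polyK B rB.
  by exists o; split=> //; rewrite -(subrKC z o); exact: affB.
have DB p : (p <= B)%MS -> sight_cone z K p <-> forall i, dot (a i) p <= 0.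
  move=> pB; rewrite -visual_coneE.
  have -> : visual_cone z K (z + p) <->
      (visual_cone z K `&` affine_sub z B) (z + p).
    by split=> [?|[]//]; split=> //; exact: affB.
  rewrite aE; split=> [[_ ap] i|ap]; first by have := ap i; rewrite addrAC subrr add0r.
  by split; [exact: affB|move=> i; rewrite addrAC subrr add0r; exact: ap].
(* An inequality tight at [q] ignores multiples of [q], so it holds at [v + e *: (o - z)]; let [e]
   tend to [0]. *)
have tight i : dot (a i) q = 0 -> dot (a i) v <= 0.
  move=> aq; apply: (@le0_of_small _ _ (- dot (a i) (o - z))) => e e0 _.
  have [t] := closure_add_line z o q v K cK Ko clv e e0.
  rewrite DB; last by rewrite !addmx_sub ?scalemx_sub.
  move=> /(_ i); rewrite (dotDr _ (v + _)) (dotDr _ v) !dotZr aq mulr0 addr0 mulrN.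
  by lra.
have [i _|i _|t tP] := @absorb_negative R _ (enum 'I_n)
    (fun i => dot (a i) q) (fun i => dot (a i) v).
- by move: i; apply/DB.
- exact: tight.
exists t; apply/DB; first by rewrite addmx_sub ?scalemx_sub.
by move=> i; rewrite dotDr dotZr; apply: tP; rewrite mem_enum.
Qed.

(** * The cone of valid affine inequalities *)

(** Homogenization: placing [y] at height 1 turns affine functions of [y] into linear ones. *)
Definition lift1 {R : realType} {d} (y : 'rV[R]_d) : 'rV[R]_(d + 1) :=
  row_mx y 1%:M.

Lemma dot_lift1 {R : realType} {d} (c : 'rV[R]_(d + 1)) y :
  dot c (lift1 y) = dot (lsubmx c) y + rsubmx c 0 0.
Proof.
rewrite /dot -{1}[c]hsubmxK tr_row_mx mul_row_col mxE; congr (_ + _).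
by rewrite trmx1 mulmx1.
Qed.

(* The pair [(a, - b)] stands for the inequality [dot a y <= b] on [K]. *)
Definition valid_cone {R : realType} {d} (K : set 'rV[R]_d) :
  set 'rV[R]_(d + 1) := [set c | forall y, K y -> dot c (lift1 y) <= 0].

Lemma valid_cone_cone {R : realType} {d} (K : set 'rV[R]_d) :
  convex_cone (valid_cone K).
Proof.
split=> [y _|a b Na Nb y Ky|t a t0 Na y Ky].
- by rewrite dot0l.
- by rewrite -[leRHS]addr0 dotDl lerD ?Na ?Nb.
- by rewrite dotZl mulr_ge0_le0 ?Na.
Qed.

(** Adding multiples of [q] does not change the value at [y], and the inequality at [y] is a closed
    condition. *)
Lemma closure_tight_le0 {R : realType} {d} (K : set 'rV[R]_d) q v y :
  closure (add_line (valid_cone K) q) v -> K y -> dot q (lift1 y) = 0 ->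
  dot v (lift1 y) <= 0.
Proof.
move=> clv Ky qy; rewrite dotC.
have cl : closed (dot (lift1 y) @^-1` [set x | x <= 0]).
  apply: preimage_closed; last exact: closed_le.
  by move=> x _; exact: dot_continuous.
apply: (cl v); apply: closure_subset clv => c [t /(_ y Ky)] /=.
by rewrite dotDl dotZl qy mulr0 addr0 dotC.
Qed.

(** Any [t >= 0] serves where [v] is negative. The rest [K'] of [K] is compact, so there [q] stays
    away from [0] and [v] is bounded. *)
Lemma compact_absorb {R : realType} {d} (K : set 'rV[R]_d) q v :
  compact K -> valid_cone K q ->
  (forall y, K y -> 0 <= dot v (lift1 y) -> dot q (lift1 y) < 0) ->
  add_line (valid_cone K) q v.
Proof.
move=> cK Nq vq.
pose f (c : 'rV[R]_(d + 1)) y := dot (lsubmx c) y + rsubmx c 0 0.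
have fE c y : dot c (lift1 y) = f c y by exact: dot_lift1.
have cf c : continuous (f c).
  by move=> y; exact: (cvgD (@dot_continuous R d (lsubmx c) y) (cvg_cst _)).
pose K' := K `&` (f v @^-1` [set x | 0 <= x]).
have cK' : compact K'.
  apply: compact_closedI => //; apply: preimage_closed; last exact: closed_ge.
  by move=> x _; exact: cf.
have [K'0|K'0] := pselect (K' !=set0); last first.
  exists 0; rewrite scale0r addr0 => y Ky; rewrite leNgt; apply/negP => vy.
  by apply: K'0; exists y; split=> //=; rewrite -fE ltW.
have wcf c : {within K', continuous (f c)} by exact: continuous_subspaceT.
have [y1 /[!inE] K'y1 maxq] := EVT_max_rV K'0 cK' (wcf q).
have [y2 /[!inE] K'y2 maxv] := EVT_max_rV K'0 cK' (wcf v).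
have q1 : f q y1 < 0.
  by rewrite -fE; case: K'y1 => Ky1 vy1; apply: vq => //; rewrite fE.
have v2 : 0 <= f v y2 by case: K'y2.
(* On [K'], [t * q <= t * q(y1) = - v(y2) <= - v]. *)
pose t := - f v y2 / f q y1.
have t0 : 0 <= t by rewrite /t mulNr -mulrN -invrN divr_ge0 // oppr_ge0 ltW.
exists t => y Ky; rewrite dotDl dotZl !fE.
have [vy|vy] := leP 0 (f v y); last first.
  have := Nq y Ky; rewrite fE => qy.
  by rewrite -[leRHS]addr0; apply: lerD; [exact: ltW|exact: mulr_ge0_le0].
have K'y : K' y by split.
have h1 : f v y <= f v y2 by apply: maxv; rewrite inE.
have h2 : t * f q y <= t * f q y1.
  by apply: ler_wpM2l => //; apply: maxq; rewrite inE.
have h3 : t * f q y1 = - f v y2 by rewrite /t divfK // lt_eqF.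
by rewrite h3 in h2; lra.
Qed.

(** A matrix with [d > 2] rows and two columns has a nonzero left kernel. *)
Lemma exists_orthogonal {R : realType} {d} (a b : 'rV[R]_d) : (2 < d)%N ->
  exists2 w : 'rV[R]_d, w != 0 & dot a w = 0 /\ dot b w = 0.
Proof.
move=> d2; pose M := (col_mx a b)^T.
have : kermx M != 0.
  rewrite -mxrank_eq0 mxrank_ker -lt0n subn_gt0.
  exact: leq_ltn_trans (rank_leq_col M) d2.
move=> /rowV0Pn[w /sub_kermxP wM w0]; exists w => //.
move: wM; rewrite /M tr_col_mx mul_mx_row => /(congr1 (fun m => (lsubmx m, rsubmx m))).
rewrite row_mxKl row_mxKr => -[wa wb].
by rewrite !(dotC _ w) /dot wa wb !mxE.
Qed.

Lemma interior_move {R : realType} {d} (K : set 'rV[R]_d) y x :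
  interior K y -> exists2 e, 0 < e & K (y + e *: x).
Proof.
move=> Ky.
have h : (fun e : R => y + e *: x) @ (0 : R) --> y.
  have : (fun e : R => y + e *: x) @ (0 : R) --> y + (0 : R) *: x.
    exact: (cvgD (cvg_cst _) (cvgZ cvg_id (cvg_cst _))).
  by rewrite scale0r addr0.
have [e /= e0 eK] := (nbhs_ballP _ _).1 (h _ Ky).
exists (e / 2); first by rewrite divr_gt0.
apply: eK; rewrite /ball /= sub0r normrN gtr0_norm ?divr_gt0 //.
by rewrite ltr_pdivrMr // mulr_natr mulr2n ltrDl.
Qed.

(** [q] vanishes along the whole line; from an interior point of [K] on it, a small move along the
    gradient [lsubmx q] would violate [q]. *)
Lemma supporting_line_valid {R : realType} {d} (K : set 'rV[R]_d) q y w :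
  valid_cone K q -> lsubmx q != 0 -> K y -> dot q (lift1 y) = 0 ->
  w != 0 -> dot (lsubmx q) w = 0 -> supporting_line K (line y w).
Proof.
move=> Nq q0 Ky qy w0 qw; exists y, w; split=> //; split=> //; split.
  by exists y; split=> //; exists 0 => //; rewrite scale0r addr0.
move=> _ [[t _ <-] Kt]; split; first exact: subset_closure.
move=> /interior_move - /(_ (lsubmx q))[e e0 Ke].
have := Nq _ Ke; move: qy; rewrite !dot_lift1 !dotDr !dotZr qw mulr0 addr0.
rewrite addrAC => ->; rewrite add0r leNgt => /negP; apply; apply: mulr_gt0 => //.
by rewrite lt_neqAle eq_sym dot_eq0 q0 dot_ge0.
Qed.

(** The separating hyperplane passes through the point [y0] of [K] nearest to [p], with normal
    [p - y0]. *)
Lemma compact_separation {R : realType} {d} (K : set 'rV[R]_d) p :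
  compact K -> convex_set K -> K !=set0 -> ~ K p ->
  exists2 c, valid_cone K c & 0 < dot c (lift1 p).
Proof.
move=> cK vK K0 nKp.
pose g y := dot (y - p) (y - p).
have cg : continuous g.
  have cB (y : 'rV[R]_d) : (fun y => y - p) @ y --> y - p.
    exact: (cvgB cvg_id (cvg_cst _)).
  by move=> y; exact: (@cvg_dot R d _ (nbhs y) _ _ _ _ _ (cB y) (cB y)).
have [y0 /[!inE] Ky0 miny] := EVT_min_rV K0 cK (continuous_subspaceT cg).
pose x := p - y0.
have xle y : K y -> dot x (y - y0) <= 0.
  move=> Ky; set D := y - y0.
  (* Comparing [y0] with [y0 + t *: D] and expanding the squares gives
     [2 * dot x D <= t * dot D D]. *)
  apply: (@le0_of_small _ _ (dot D D / 2)) => t t0 t1.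
  have := miny (y0 + t *: D).
  rewrite inE => /(_ (convex_set_comb _ _ _ _ vK Ky0 Ky (ltW t0) t1)).
  rewrite /g (_ : y0 + _ - p = t *: D - x); last first.
    by apply/rowP => j; rewrite /x !mxE; ring.
  rewrite (_ : y0 - p = (-1) *: x); last by rewrite /x scaleN1r opprB.
  rewrite dot_sub_sq !(dotZl, dotZr) (dotC D x) => le_sq.
  have : 2 * dot x D <= t * dot D D by rewrite -(ler_pM2l t0); lra.
  by lra.
pose c := row_mx x (- dot x y0)%:M : 'rV_(d + 1).
have cE y : dot c (lift1 y) = dot x (y - y0).
  by rewrite dot_lift1 row_mxKl row_mxKr mxE mulr1n dotBr.
exists c => [y Ky|]; first by rewrite cE; exact: xle.
rewrite cE lt_neqAle dot_ge0 eq_sym dot_eq0 andbT subr_eq0.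
by apply/eqP => py0; apply: nKp; rewrite py0.
Qed.

Lemma valid_cone_finitely_generated {R : realType} {d} {B : Type} (K : set 'rV[R]_d)
    (z : B -> 'rV[R]_d) :
  (2 < d)%N -> compact K ->
  (forall l, supporting_line K l -> exists b, l (z b)) ->
  (forall b, finitely_generated (sight_cone (z b) K)) ->
  finitely_generated (valid_cone K).
Proof.
move=> d2 cK Kz fgz; apply: finitely_generated_closed.
  exact: valid_cone_cone.
move=> q Nq v clv.
have tight := closure_tight_le0 K q v _ clv.
have [[y [Ky qy vy]]|no_y] :=
    pselect (exists y, [/\ K y, dot q (lift1 y) = 0 & dot v (lift1 y) = 0]); last first.
  apply: compact_absorb => // y Ky vy; rewrite lt_neqAle Nq // andbT.
  apply/eqP => qy; apply: no_y; exists y; split=> //.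
  by apply/eqP; rewrite eq_le vy tight.
(* If [q] is constant, it is tight on all of [K], so [v] is already valid. *)
have [q0|q0] := eqVneq (lsubmx q) 0.
  exists 0; rewrite scale0r addr0 => x Kx; apply: tight => //.
  by move: qy; rewrite !dot_lift1 q0 !dot0l.
have [w w0 [qw vw]] := exists_orthogonal (lsubmx q) (lsubmx v) d2.
have [b [t _ zE]] := Kz _ (supporting_line_valid K q y w Nq q0 Ky qy w0 qw).
have zz c : dot c (lift1 y) = 0 -> dot (lsubmx c) w = 0 ->
    dot c (lift1 (z b)) = 0.
  by rewrite -zE !dot_lift1 dotDr dotZr => + ->; rewrite mulr0 addr0.
(* As [q] and [v] vanish at [z b], their values at [x] become linear functions of [x - z b], which
   can be tested on generators of the visual cone. *)
have diff c x : dot (lsubmx c) (x - z b) = dot c (lift1 x) - dot c (lift1 (z b)).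
  by rewrite dotBr !dot_lift1; ring.
have [s sD Ds] := fgz b.
have [g /sD[u u0 [x Kx ->]]|g /sD[u u0 [x Kx ->]]|r rP] :=
  @absorb_negative R _ s (dot (lsubmx q)) (dot (lsubmx v)).
- by rewrite dotZr diff (zz q) // subr0 mulr_ge0_le0 ?Nq.
- rewrite !dotZr !diff !zz // !subr0 => /eqP; rewrite mulf_eq0.
  by move=> /orP[/eqP ->|/eqP qx]; rewrite ?mul0r // mulr_ge0_le0 ?tight.
exists r => x Kx.
have : cone_gen s (x - z b) by apply: Ds; exists 1 => //; exists x; rewrite ?scale1r.
move=> /(_ [set p | dot (lsubmx v) p + r * dot (lsubmx q) p <= 0]) /=.
rewrite !diff !zz // !subr0 dotDl dotZl; apply=> //.
split=> [|p p' /= h h'|a p a0 /= h] /=.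
- by rewrite !dot0r mulr0 addr0.
- by rewrite !dotDr; lra.
- rewrite !dotZr mulrCA -mulrDr; exact: mulr_ge0_le0.
Qed.

(** * From finitely many inequalities to a convex hull *)

(** By separation, the generating inequalities cut out [K]. Their homogenization, with nonnegative
    height, is a polyhedral cone over [K]; its generators, rescaled to height 1, are points whose
    hull is [K]. *)
Lemma polytope_of_valid_cone {R : realType} {d} (K : set 'rV[R]_d) :
  compact K -> convex_set K -> K !=set0 ->
  finitely_generated (valid_cone K) -> polytope K.
Proof.
move=> cK vK K0 [s sN Ns].
have KP y : {in s, forall c, dot c (lift1 y) <= 0} -> K y.
  move=> sy; apply/not_notP => nKy.
  have [c Nc] := compact_separation K y cK vK K0 nKy.
  rewrite ltNge => /negP; apply.
  apply: (Ns c Nc [set c | dot c (lift1 y) <= 0]) => //=.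
  split=> [|a b /= ha hb|t a t0 /= ha] /=.
  - by rewrite dot0l.
  - by rewrite dotDl; lra.
  - by rewrite dotZl mulr_ge0_le0.
(* As an inequality, [e] says that the height is nonnegative. *)
pose e : 'rV[R]_(d + 1) := row_mx 0 (-1)%:M.
have eE p : dot e p = - rsubmx p 0 0.
  rewrite dotC /dot tr_row_mx -{1}[p]hsubmxK mul_row_col mxE.
  by rewrite trmx0 mulmx0 mxE add0r tr_scalar_mx mul_mx_scalar mxE mulN1r.
have [r rP Pr] := finitely_generated_polyhedral (e :: s).
pose P := [set p | {in e :: s, forall a, dot a p <= 0}].
have liftE (p : 'rV[R]_(d + 1)) : 0 < rsubmx p 0 0 ->
    p = rsubmx p 0 0 *: lift1 ((rsubmx p 0 0)^-1 *: lsubmx p).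
  move=> p0; rewrite /lift1 scale_row_mx scalerA divff ?gt_eqF // scale1r.
  by rewrite -[LHS]hsubmxK [in LHS](mx11_scalar (rsubmx p)) scale_scalar_mx mulr1.
have PK p : P p -> 0 < rsubmx p 0 0 -> K ((rsubmx p 0 0)^-1 *: lsubmx p).
  move=> Pp p0; apply: KP => c sc; rewrite -(ler_pM2l p0) mulr0 -dotZr -liftE //.
  by apply: Pp; rewrite inE sc orbT.
(* A generator at height 0 would be a recession direction of [K]. *)
have P0 p : P p -> rsubmx p 0 0 = 0 -> p = 0.
  move=> Pp p0.
  suff x0 : lsubmx p = 0.
    by rewrite -[p]hsubmxK x0 (mx11_scalar (rsubmx p)) p0 raddf0 row_mx0.
  have [y Ky] := K0; set x := lsubmx p.
  have Kray u : 0 <= u -> K (y + u *: x).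
    move=> u0; apply: KP => c sc.
    have := Pp c; rewrite inE sc orbT => /(_ isT).
    have -> : dot c p = dot (lsubmx c) x.
      rewrite /dot -{1}[c]hsubmxK -{1}[p]hsubmxK tr_row_mx mul_row_col mxE.
      by rewrite (mx11_scalar (rsubmx p)) p0 raddf0 trmx0 mulmx0 [X in _ + X]mxE addr0.
    have := sN c sc y Ky; rewrite !dot_lift1 dotDr dotZr => yc xc.
    by rewrite addrAC -[leRHS]addr0 lerD // mulr_ge0_le0.
  have [M [_ KM]] := compact_bounded cK.
  have {}KM y' : K y' -> `|y'| <= M + 1 by apply: KM; rewrite ltrDl.
  apply/eqP; rewrite -normr_eq0; apply/negP => /negP nx.
  have x0 : 0 < `|x| by rewrite lt_neqAle eq_sym nx normr_ge0.
  have M0 : 0 <= M + 1 by apply: le_trans (KM y Ky).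
  (* Chosen so that the norm of [u *: x] exceeds that of [y] by more than the bound [M + 1] on
     [K]. *)
  pose u := (`|y| + (M + 1) + 1) / `|x|.
  have u0 : 0 <= u by rewrite /u divr_ge0 // addr_ge0 // addr_ge0.
  have := KM _ (Kray u u0); rewrite leNgt => /negP; apply.
  have := ler_normB (y + u *: x) y; rewrite [y + _]addrC addrK normrZ (ger0_norm u0).
  by rewrite /u divfK ?gt_eqF //; lra.
pose f (g : 'rV[R]_(d + 1)) := (rsubmx g 0 0)^-1 *: lsubmx g.
pose r' := [seq f g | g <- r & 0 < rsubmx g 0 0].
have r'K y : y \in r' -> K y.
  by move=> /mapP[g]; rewrite mem_filter => /andP[g0 gr] ->; exact: PK (rP _ gr) g0.
exists r'; apply/seteqP; split=> y.
  move=> Ky; have : cone_gen [seq lift1 x | x <- r'] (lift1 y).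
    apply: (sub_cone_gen r); last first.
      apply: Pr => a; rewrite inE => /predU1P[->|/sN]; last exact.
      by rewrite eE row_mxKr mxE oppr_le0 ler01.
    move=> g gr; have [g0|g0] := ltP 0 (rsubmx g 0 0).
      have [_ _ cZ] := cone_gen_cone [seq lift1 x | x <- r'].
      rewrite (liftE g g0); apply: cZ; first exact: ltW.
      by apply: mem_cone_gen; do 2!apply: map_f; rewrite mem_filter g0.
    rewrite (P0 g); [by case: (cone_gen_cone [seq lift1 x | x <- r'])|exact: rP|].
    apply/eqP; rewrite eq_le g0 /= -oppr_le0 -eE; apply: rP => //.
    by rewrite mem_head.
  move=> /(cone_gen_map 0)[w w0 yE].
  have yE' : lift1 y = \sum_i w 0 i *: lift1 r'`_i.
    by rewrite yE mulmx_sum_row; apply: eq_bigr => i _; rewrite rowK.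
  (* The last coordinate of [yE'] says that the weights sum to 1, the others express [y]. *)
  exists (w 0); split=> //; split.
    have := congr1 (fun p : 'rV_(d + 1) => rsubmx p 0 0) yE'.
    rewrite row_mxKr linear_sum summxE mxE mulr1n => ->.
    by apply: eq_bigr => i _; rewrite linearZ /= row_mxKr !mxE mulr1.
  have := congr1 lsubmx yE'; rewrite row_mxKl linear_sum => ->.
  by apply: eq_bigr => i _; rewrite linearZ /= row_mxKl.
move=> [w [w0 [w1 ->]]]; apply: KP => c sc.
rewrite dot_lift1 -[rsubmx c 0 0]mul1r -w1 mulr_suml.
have -> : dot (lsubmx c) (\sum_i w i *: r'`_i) = \sum_i w i * dot (lsubmx c) r'`_i.
  rewrite /dot linear_sum mulmx_sumr summxE.
  by apply: eq_bigr => i _; rewrite -[LHS]/(dot _ (w i *: r'`_i)) dotZr.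
rewrite -big_split /=; apply: sumr_le0 => i _.
rewrite -mulrDr -dot_lift1 mulr_ge0_le0 //; apply: sN => //.
by apply: r'K; exact: mem_nth.
Qed.

Theorem theorem2 (R : realType) (d k : nat) (K : set 'rV[R]_d)
  (B : Type) (z : B -> 'rV[R]_d) :
  (3 <= d)%N ->
  convex_body K ->
  (forall b, ~ K (z b)) ->
  (forall l, supporting_line K l -> exists b, l (z b)) ->
  (3 <= k)%N -> (k <= d)%N ->
  (forall b, all_k_visual_cones_polyhedral k (z b) K) ->
  polytope K.
Proof.
move=> d3 [cK [vK iK]] _ Kz k3 kd polyK.
have K0 : K !=set0 by case: iK => y /interior_subset; exists y.
apply: polytope_of_valid_cone => //.
apply: (valid_cone_finitely_generated K z) => // b.
exact: (sight_cone_finitely_generated (z b) K vK iK k3 kd (polyK b)).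
Qed.
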